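(* Let $M=\mathrm{diag}(2,3)$, let $q,n\in\mathbb{N}$ (both $\ge1$) with $n\ge q$, and let $\ell\in\{0,\dots,n-1\}$. Let $B_{n,\ell}(z_1,z_2)$ be the symbol of the anisotropic symmetric four directional approximating scheme of order $(n,\ell)$, and put $\hat B(\mathbf{x})=B_{n,\ell}(e^{-\mathrm{i}x_1},e^{-\mathrm{i}x_2})$ for $\mathbf{x}=(x_1,x_2)\in\mathbb{R}^2$. Then (i) for every $\mathbf{y}=(y_1,y_2)\ne(0,0)$ with $y_1\in\{0,\frac12\}$ and $y_2\in\{0,\frac13,\frac23\}$, $$\limsup_{\mathbf{x}\in\mathbb{R}^2,\ \|\mathbf{x}\|\to0}\frac{|\hat B(\mathbf{x}+2\pi\mathbf{y})|}{\|\mathbf{x}\|^{2q}}<\infty;$$ (ii) $$\limsup_{\mathbf{x}\in\mathbb{R}^2,\ \|\mathbf{x}\|\to0}\frac{|\hat B(\mathbf{x})-6|}{\|\mathbf{x}\|}<\infty.$$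
   Context: For $k\ge1$ let $$B_k(z_1,z_2)=6\left(\frac{(1+z_1)^2}{4z_1}\,\frac{(1+z_2+z_2^2)^2}{9z_2^2}\right)^{\lceil k/2\rceil}\left(\frac{(2+z_2+z_1z_2+2z_1z_2^2)(2z_1+z_2+z_1z_2+2z_2^2)}{36z_1z_2^2}\right)^{\lfloor k/2\rfloor},\quad (z_1,z_2)\in(\mathbb{C}\setminus\{0\})^2.$$ For $n\ge1$ and $\ell\in\{0,\dots,n-1\}$ the symbol of the anisotropic symmetric four directional approximating scheme of order $(n,\ell)$ and dilation $M=\mathrm{diag}(2,3)$ is $$B_{n,\ell}(z_1,z_2)=\sum_{i=0}^{\ell}B_{n-i}(z_1,z_2)\sum_{j=0}^{i}\mathrm{c}_n^{(i,j)}\,\delta_1(z_1)^{i-j}\,\delta_2(z_2)^{j},\qquad \delta_1(z_1)=-\frac{(1-z_1^2)^2}{16z_1^2},\quad \delta_2(z_2)=-\frac{(1-z_2^3)^2}{27z_2^3},$$ where the real coefficients $\mathrm{c}_n^{(i,j)}$ are computed recursively (in $i$) as the solution of the system $B_{n,\ell}(1,1)=6$ and $D^{(2(i-j),2j)}B_{n,\ell}(1,1)=0$ for $j=0,\dots,i$, $i=1,\dots,\ell$. Here $D^{(\mu_1,\mu_2)}=\partial^{\mu_1+\mu_2}/\partial z_1^{\mu_1}\partial z_2^{\mu_2}$. In particular $\mathrm{c}_n^{(0,0)}=1$. Limits superior are taken over $\mathbf{x}\ne\mathbf{0}$. *)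

(* Defs.v *)
From HB Require Import structures.
From mathcomp Require Import all_boot all_order all_algebra.
From mathcomp Require Import all_classical all_reals all_analysis.
From mathcomp Require Import complex.

Set Implicit Arguments.
Unset Strict Implicit.
Unset Printing Implicit Defensive.

Import Order.TTheory GRing.Theory Num.Theory.
Import numFieldNormedType.Exports.

Local Open Scope classical_set_scope.
Local Open Scope ring_scope.
Local Open Scope complex_scope.

(* D^(m1,m2) f (a1,a2).  Instantiated at K := R[i], these are complex (not
   real) partial derivatives.  The z2-derivatives are taken first; for the
   symbols below, which are holomorphic off the axes, the order is immaterial. *)
Definition pderive {K : numFieldType} (m1 m2 : nat) (f : K -> K -> K)
    (a1 a2 : K) : K :=
  derive1n m1 (fun z1 : K => derive1n m2 (f z1 : K -> K^o) a2 : K^o) a1.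

Section Symbols.
Context {R : realType}.
Implicit Types (z : R[i]) (c : nat -> nat -> R).

(* As [x^-1] is total, the expressions below also have values when z1 = 0 or
   z2 = 0; these are junk and are never used. *)

Definition fourdir_symbol (k : nat) z1 z2 : R[i] :=
  6 * ((1 + z1) ^+ 2 / (4 * z1)
       * ((1 + z2 + z2 ^+ 2) ^+ 2 / (9 * z2 ^+ 2))) ^+ uphalf k
    * ((2 + z2 + z1 * z2 + 2 * z1 * z2 ^+ 2)
       * (2 * z1 + z2 + z1 * z2 + 2 * z2 ^+ 2)
       / (36 * z1 * z2 ^+ 2)) ^+ k./2.

Definition delta1 z1 : R[i] := - ((1 - z1 ^+ 2) ^+ 2 / (16 * z1 ^+ 2)).

Definition delta2 z2 : R[i] := - ((1 - z2 ^+ 3) ^+ 2 / (27 * z2 ^+ 3)).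

Definition approx_symbol c (n l : nat) z1 z2 : R[i] :=
  \sum_(0 <= i < l.+1) fourdir_symbol (n - i) z1 z2
    * \sum_(0 <= j < i.+1) (c i j)%:C * delta1 z1 ^+ (i - j) * delta2 z2 ^+ j.

(* The system is triangular: c i j enters the equation of index (i, j) with
   coefficient 6 (-1/4)^(i-j) (-1/3)^j (2(i-j))! (2j)!, and the other unknowns
   in that equation have a smaller first index.  Hence c i j exists, is unique
   for j <= i <= l, and does not depend on l; the other values of c are
   irrelevant. *)
Definition scheme_coefficients (n l : nat) c : Prop :=
  approx_symbol c n l 1 1 = 6 /\
  forall i j : nat, (1 <= i <= l)%N -> (j <= i)%N ->
    pderive (2 * (i - j)) (2 * j) (approx_symbol c n l) 1 1 = 0.

(* e^(-i t) *)
Definition expNi (t : R) : R[i] := cos t -i* sin t.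

Definition approx_symbol_hat c (n l : nat) (x : R * R) : R[i] :=
  approx_symbol c n l (expNi x.1) (expNi x.2).

(* The library's norm on R * R is the sup norm. *)
Definition enorm (x : R * R) : R := Num.sqrt (x.1 ^+ 2 + x.2 ^+ 2).

Definition limsup0 (f : R * R -> R) : \bar R :=
  limf_esup (EFin \o f) (0 : R * R)^'.

(* The modulus in R; the library's [`|z|] lives in R[i]. *)
Definition cmod z : R := complex.Re `|z|.

End Symbols.

(* Main.v *)
Require Import Defs.
From mathcomp Require Import all_boot all_order all_algebra.
From mathcomp Require Import all_classical all_reals all_analysis.
From mathcomp Require Import complex.
From mathcomp Require Import ring lra zify.

Import Order.TTheory GRing.Theory Num.Theory.
Import numFieldNormedType.Exports.
Local Open Scope classical_set_scope.
Local Open Scope ring_scope.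

(** Every term of the symbol B_(n,l) is a constant times
    B_(n-i) * delta1^(i-j) * delta2^j, and each of its three ingredients can be
    read off at the points (a, b) = (e^(-i s), e^(-i t)), where a = 1 or a = -1
    and b is a cube root of unity.  If (a, b) <> (1, 1), then B_k vanishes there
    to order 2k (lemma vanishes_fourdir_symbol):

    - B_k is, up to the constant 6, the product of the power uphalf k of a box
      factor, in which (1 + z1)^2 and (1 + z2 + z2^2)^2 occur, and the power
      k./2 of a diagonal factor, in which two polynomials are multiplied;
    - when exactly one of a, b differs from 1, exactly one of the two squares in
      the box factor is zero, and both polynomials of the diagonal factor are
      zero: the order is at least 2 uphalf k + 2 k./2 = 2k;
    - when both differ from 1, the diagonal factor does not help, but both squares
      in the box factor are zero: the order is at least 4 uphalf k >= 2k.

    Moreover delta1 and delta2 vanish to order 2 at all these points, since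
    a^2 = b^3 = 1.  So the term of index (i, j) vanishes to order
    2 (n - i) + 2 (i - j) + 2 j = 2n, whatever its coefficient is
    (vanishes_approx_symbol), and 2n >= 2q gives the first claim.

    For the second claim, x |-> B_(n,l)(e^(-i x1), e^(-i x2)) differs from its
    value at 0 by at most a multiple of |x| (tends_approx_symbol), and the
    normalisation B_(n,l)(1, 1) = 6 says what that value is.

    Both parts rest on a small calculus of orders of vanishing at the origin
    (vanishes, tends), whose only analytic input is |e^(-i t) - 1| <= |t|. *)

(** * Moduli and the Euclidean norm *)

Section Modulus.
Context {R : realType}.
Implicit Types (z w : R[i]) (s t : R) (x : R * R).

Lemma normCE z : `|z| = ((cmod z)%:C)%C.
Proof. by rewrite /cmod normc_def. Qed.

Lemma cmod_ge0 z : 0 <= cmod z.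
Proof. by rewrite -lecR -normCE normr_ge0. Qed.

Lemma cmodM z w : cmod (z * w) = cmod z * cmod w.
Proof. by apply: complexI; rewrite rmorphM /= -!normCE normrM. Qed.

Lemma cmodX z k : cmod (z ^+ k) = cmod z ^+ k.
Proof. by apply: complexI; rewrite rmorphXn /= -!normCE normrX. Qed.

Lemma cmodV z : cmod z^-1 = (cmod z)^-1.
Proof. by apply: complexI; rewrite fmorphV /= -!normCE normfV. Qed.

Lemma cmodN z : cmod (- z) = cmod z.
Proof. by apply: complexI; rewrite -!normCE normrN. Qed.

Lemma cmodD z w : cmod (z + w) <= cmod z + cmod w.
Proof. by rewrite -lecR rmorphD /= -!normCE ler_normD. Qed.

Lemma cmod_eq0 z : (cmod z == 0) = (z == 0).
Proof. by rewrite -(inj_eq (@complexI R)) -normCE normr_eq0. Qed.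

Lemma cmodCE s t : cmod (Complex s t) = Num.sqrt (s ^+ 2 + t ^+ 2).
Proof. by rewrite /cmod normc_def. Qed.

Lemma cmod_expNi t : cmod (expNi t) = 1.
Proof. by rewrite cmodCE sqrrN cos2Dsin2 sqrtr1. Qed.

Lemma expNiD s t : expNi (s + t) = expNi s * expNi t.
Proof.
rewrite /expNi cosD sinD; apply/eqP; rewrite eq_complex /= mulrNN eqxx /=.
by apply/eqP; ring.
Qed.

Lemma expNi0 : expNi 0 = 1 :> R[i].
Proof. by rewrite /expNi cos0 sin0 oppr0. Qed.

Lemma ler_norm_sin t : `|sin t| <= `|t|.
Proof.
wlog t_ge0 : t / 0 <= t.
  move=> H; have [/H//|/ltW t_le0] := leP 0 t.
  by rewrite -normrN -sinN -(normrN t); apply: H; rewrite oppr_ge0.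
have [x _ e] : exists2 c : R, c \in `[0, t]%R & sin t - sin 0 = cos c * (t - 0).
  apply: (@MVT_segment R sin cos) => //.
  exact/continuous_subspaceT/continuous_sin.
have -> : sin t = cos x * t by move: e; rewrite sin0 !subr0.
by rewrite normrM ler_piMl// cos_max.
Qed.

(** The chord is at most the arc: |e^(-it) - 1| = 2 |sin (t/2)|. *)
Lemma cmod_expNiB1 t : cmod (expNi t - 1) <= `|t|.
Proof.
have [u tE] : exists u, t = u *+ 2.
  by exists (t / 2); rewrite -[RHS]mulr_natr divfK// pnatr_eq0.
have e2 : cmod (expNi t - 1) ^+ 2 = (2 * sin u) ^+ 2.
  have -> : expNi t - 1 = Complex (cos t - 1) (- sin t).
    by apply/eqP; rewrite eq_complex /= subr0 !eqxx.
  rewrite cmodCE sqr_sqrtr ?addr_ge0 ?sqr_ge0 //.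
  rewrite sqrrN tE cos_mulr2n sin_mulr2n.
  rewrite -[(cos u * sin u) *+ 2]mulr_natl !exprMn cos2sin2; ring.
have -> : cmod (expNi t - 1) = `|2 * sin u|.
  apply/eqP; rewrite -(eqrXn2 (n:=2)) ?cmod_ge0 // ?normr_ge0 //.
  by rewrite real_normK ?num_real // e2.
rewrite tE -[u *+ 2]mulr_natl !normrM ler_wpM2l ?normr_ge0 //.
exact: ler_norm_sin.
Qed.

Lemma enorm_ge0 x : 0 <= enorm x.
Proof. exact: sqrtr_ge0. Qed.

Lemma enorm_gt0 x : x != 0 -> 0 < enorm x.
Proof.
case: x => a b ab0; rewrite /enorm sqrtr_gt0 /=.
rewrite lt_neqAle addr_ge0 ?sqr_ge0 // andbT eq_sym paddr_eq0 ?sqr_ge0 //.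
by rewrite !sqrf_eq0.
Qed.

Lemma ler_fst_enorm x : `|x.1| <= enorm x.
Proof. by rewrite -sqrtr_sqr ler_wsqrtr // lerDl sqr_ge0. Qed.

Lemma ler_snd_enorm x : `|x.2| <= enorm x.
Proof. by rewrite -sqrtr_sqr ler_wsqrtr // lerDr sqr_ge0. Qed.

Lemma enorm_le1_nbhs : \forall x \near (0 : R * R), enorm x <= 1.
Proof.
apply/nbhs_ballP; exists (1 / 2) => /=; first by rewrite divr_gt0.
move=> [a b] [/=]; rewrite -!ball_normE /= !sub0r !normrN => ha hb.
rewrite /enorm /= -[leRHS]sqrtr1 ler_wsqrtr //.
rewrite -(real_normK (num_real a)) -(real_normK (num_real b)).
by have := normr_ge0 a; have := normr_ge0 b; nra.
Qed.

End Modulus.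

(** * Orders of vanishing at the origin *)

Section Vanishing.
Set Implicit Arguments.
Unset Strict Implicit.
Context {R : realType}.
Implicit Types (f g : R * R -> R[i]) (a b : R[i]) (k m : nat).

(** The bound is asked on the whole unit ball, not just near 0, so that the rules
    of the calculus are plain inequalities; the ball has radius 1 because there
    the powers of the norm decrease (vanishesW). *)
Definition vanishes k f : Prop :=
  exists C : R, forall x, enorm x <= 1 -> cmod (f x) <= C * enorm x ^+ k.

(** Convergence at a linear rate: a factor that tends to 0 contributes one unit
    to the order of vanishing of a product. *)
Definition tends f a : Prop := vanishes 1 (fun x => f x - a).

Lemma vanishes_ge0 k f : vanishes k f ->
  exists2 C : R, 0 <= C &
    forall x, enorm x <= 1 -> cmod (f x) <= C * enorm x ^+ k.
Proof.
move=> [C hC]; exists `|C| => // x /hC /le_trans; apply.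
by rewrite ler_wpM2r ?exprn_ge0 ?enorm_ge0 ?ler_norm.
Qed.

Lemma vanishes_ext k f g : f =1 g -> vanishes k f -> vanishes k g.
Proof. by move=> /funext ->. Qed.

Lemma vanishesW m k f : (m <= k)%N -> vanishes k f -> vanishes m f.
Proof.
move=> mk /vanishes_ge0[C C0 hC]; exists C => x x1; apply: le_trans (hC x x1) _.
by rewrite ler_wpM2l // ler_wiXn2l ?enorm_ge0.
Qed.

Lemma vanishes0 k : vanishes k (fun=> 0).
Proof.
exists 0 => x _; rewrite mul0r.
by have /eqP -> : cmod (0 : R[i]) == 0 by rewrite cmod_eq0.
Qed.

Lemma vanishesN k f : vanishes k f -> vanishes k (fun x => - f x).
Proof. by move=> [C hC]; exists C => x x1; rewrite cmodN hC. Qed.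

Lemma vanishesD k f g : vanishes k f -> vanishes k g ->
  vanishes k (fun x => f x + g x).
Proof.
move=> [C hC] [D hD]; exists (C + D) => x x1.
by rewrite (le_trans (cmodD _ _)) // mulrDl lerD ?hC ?hD.
Qed.

Lemma vanishesM k m f g : vanishes k f -> vanishes m g ->
  vanishes (k + m) (fun x => f x * g x).
Proof.
move=> [C hC] [D hD]; exists (C * D) => x x1.
by rewrite cmodM exprD mulrACA ler_pM ?cmod_ge0 ?hC ?hD.
Qed.

Lemma vanishes_cst a : vanishes 0 (fun=> a).
Proof. by exists (cmod a) => x _; rewrite expr0 mulr1. Qed.

Lemma vanishesX k m f : vanishes k f -> vanishes (k * m) (fun x => f x ^+ m).
Proof.
move=> hf; elim: m => [|m IH]; first by rewrite muln0; apply: vanishes_cst.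
rewrite mulnS; apply: vanishes_ext (vanishesM hf IH) => x.
by rewrite exprS.
Qed.

Lemma vanishes_sum k (r : seq nat) (F : nat -> R * R -> R[i]) :
  (forall i, i \in r -> vanishes k (F i)) ->
  vanishes k (fun x => \sum_(i <- r) F i x).
Proof.
elim: r => [_|i r IH h].
  by apply: vanishes_ext (vanishes0 k) => x; rewrite big_nil.
have hi : vanishes k (F i) by apply: h; rewrite mem_head.
have hr : vanishes k (fun x => \sum_(i <- r) F i x).
  by apply: IH => j jr; apply: h; rewrite in_cons jr orbT.
by apply: vanishes_ext (vanishesD hi hr) => x; rewrite big_cons.
Qed.

(** The infimum defining the limit superior is at most the supremum over the
    punctured unit ball. *)
Lemma limsup0_vanishes k f : vanishes k f ->
  (limsup0 (fun x => cmod (f x) / enorm x ^+ k)%R < +oo)%E.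
Proof.
move=> [C hC]; apply: (@le_lt_trans _ _ C%:E); last exact: ltry.
rewrite /limsup0 limf_esupE; apply: ge_ereal_inf.
exists (ereal_sup ((EFin \o (fun x => cmod (f x) / enorm x ^+ k)%R) @`
    [set x : R * R | enorm x <= 1 /\ x != 0])).
  eexists; last reflexivity.
  rewrite /dnbhs /within /=; near=> x => x0; split => //.
  by near: x; exact: enorm_le1_nbhs.
apply: ge_ereal_sup => _ [x [x1 x0] <-] /=.
by rewrite lee_fin ler_pdivrMr ?exprn_gt0 ?enorm_gt0 ?hC.
Unshelve. all: by end_near. Qed.

Lemma tends_vanishes0 f a : tends f a -> vanishes 0 f.
Proof.
move=> /(vanishesW (leq0n 1)) hf.
by apply: vanishes_ext (vanishesD hf (vanishes_cst a)) => x; rewrite subrK.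
Qed.

Lemma tends0_vanishes f a : tends f a -> a = 0 -> vanishes 1 f.
Proof. by move=> hf a0; apply: vanishes_ext hf => x; rewrite a0 subr0. Qed.

Lemma tends_cst a : tends (fun=> a) a.
Proof. by apply: vanishes_ext (vanishes0 1) => x; rewrite subrr. Qed.

Lemma tendsN f a : tends f a -> tends (fun x => - f x) (- a).
Proof. by move=> /vanishesN; apply: vanishes_ext => x; rewrite opprD. Qed.

Lemma tendsD f g a b : tends f a -> tends g b ->
  tends (fun x => f x + g x) (a + b).
Proof.
move=> hf hg; apply: vanishes_ext (vanishesD hf hg) => x.
by rewrite opprD addrACA.
Qed.

(** f g - a b = f (g - b) + (f - a) b, where f is bounded. *)
Lemma tendsM f g a b : tends f a -> tends g b ->
  tends (fun x => f x * g x) (a * b).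
Proof.
move=> hf hg; have /= h1 := vanishesM (tends_vanishes0 hf) hg.
have /= h2 := vanishesM hf (vanishes_cst b).
by apply: vanishes_ext (vanishesD h1 h2) => x; ring.
Qed.

Lemma tendsX f a m : tends f a -> tends (fun x => f x ^+ m) (a ^+ m).
Proof.
move=> hf; elim: m => [|m IH]; first exact: tends_cst.
by apply: vanishes_ext (tendsM hf IH) => x; rewrite !exprS.
Qed.

(** A constant modulus keeps f away from 0 on the whole ball; the denominators
    of the symbols, monomials in points of the unit circle, have one. *)
Lemma tendsV f a : a != 0 -> (forall x, cmod (f x) = cmod a) ->
  tends f a -> tends (fun x => (f x)^-1) a^-1.
Proof.
move=> a0 fa [C hC]; exists (C * (cmod a ^+ 2)^-1) => x x1.
have fx0 : f x != 0 by rewrite -cmod_eq0 fa cmod_eq0.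
have -> : (f x)^-1 - a^-1 = - (f x - a) * ((f x)^-1 * a^-1) by field; apply/andP.
rewrite cmodM cmodN cmodM !cmodV fa -invfM -expr2 mulrAC.
by rewrite ler_wpM2r ?invr_ge0 ?exprn_ge0 ?cmod_ge0 ?hC.
Qed.

Lemma tends_sum (r : seq nat) (F : nat -> R * R -> R[i]) (A : nat -> R[i]) :
  (forall i, tends (F i) (A i)) ->
  tends (fun x => \sum_(i <- r) F i x) (\sum_(i <- r) A i).
Proof.
move=> h; elim: r => [|i r IH].
  by apply: vanishes_ext (vanishes0 1) => x; rewrite !big_nil subrr.
by apply: vanishes_ext (tendsD (h i) IH) => x; rewrite !big_cons.
Qed.

Lemma tends_expNi_comp (u : R * R -> R) (s : R) :
  (forall x, `|u x| <= enorm x) -> tends (fun x => expNi (u x + s)) (expNi s).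
Proof.
move=> hu; exists 1 => x _; rewrite mul1r expr1.
have -> : expNi (u x + s) - expNi s = (expNi (u x) - 1) * expNi s.
  by rewrite expNiD mulrBl mul1r.
by rewrite cmodM cmod_expNi mulr1 (le_trans (cmod_expNiB1 _)).
Qed.

End Vanishing.

(** * Zeros of the symbols *)

Section Symbol.
Context {R : realType}.
Set Implicit Arguments.
Unset Strict Implicit.
Implicit Types (s t : R) (k : nat).

Lemma expNi_neq0 t : expNi t != 0.
Proof. by rewrite -cmod_eq0 cmod_expNi oner_eq0. Qed.

(** The coordinates of the point of the torus with arguments x + (s, t). *)
Definition zfst s (x : R * R) : R[i] := expNi (x.1 + s).
Definition zsnd t (x : R * R) : R[i] := expNi (x.2 + t).

Lemma tends_zfst s : tends (zfst s) (expNi s).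
Proof. exact: (tends_expNi_comp s (@ler_fst_enorm R)). Qed.

Lemma tends_zsnd t : tends (zsnd t) (expNi t).
Proof. exact: (tends_expNi_comp t (@ler_snd_enorm R)). Qed.

(** The limit may be an existential variable: it is built from the shape of the
    function alone.  For an inverse the limit is found first, because the
    side conditions of tendsV mention it. *)
Ltac solve_tends :=
  lazymatch goal with
  | |- tends (fun _ => ?c) _ => exact: (tends_cst c)
  | |- tends (fun x => zfst _ x) _ => exact: tends_zfst
  | |- tends (fun x => zsnd _ x) _ => exact: tends_zsnd
  | |- tends (fun x => - @?f x) _ =>
      refine (@tendsN _ f _ _); solve_tends
  | |- tends (fun x => @?f x + @?g x) _ =>
      refine (@tendsD _ f g _ _ _ _); solve_tends
  | |- tends (fun x => @?f x * @?g x) _ =>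
      refine (@tendsM _ f g _ _ _ _); solve_tends
  | |- tends (fun x => @?f x ^+ ?m) _ =>
      refine (@tendsX _ f _ m _); solve_tends
  | |- tends (fun x => (@?f x)^-1) _ =>
      refine (@tendsV _ f _ _ _ _); cycle 2;
      [ solve_tends
      | by rewrite ?mulf_neq0 ?expf_neq0 ?expNi_neq0 ?pnatr_eq0
      | by move=> x; rewrite ?cmodM ?cmodX ?cmod_expNi ]
  end.

Definition box_fst (z1 : R[i]) : R[i] := (1 + z1) ^+ 2 / (4 * z1).
Definition box_snd (z2 : R[i]) : R[i] := (1 + z2 + z2 ^+ 2) ^+ 2 / (9 * z2 ^+ 2).
Definition diag_factor (z1 z2 : R[i]) : R[i] :=
  (2 + z2 + z1 * z2 + 2 * z1 * z2 ^+ 2) * (2 * z1 + z2 + z1 * z2 + 2 * z2 ^+ 2)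
  / (36 * z1 * z2 ^+ 2).

Lemma tends_approx_symbol c n l s t :
  tends (fun x => approx_symbol c n l (zfst s x) (zsnd t x))
        (approx_symbol c n l (expNi s) (expNi t)).
Proof.
apply: tends_sum => i; apply: tendsM.
  by rewrite /fourdir_symbol; solve_tends.
by apply: tends_sum => j; rewrite /delta1 /delta2; solve_tends.
Qed.

Lemma vanishes_div m f g a :
  vanishes m f -> tends (fun x : R * R => (g x)^-1) a ->
  vanishes m (fun x => f x / g x).
Proof.
by move=> hf /tends_vanishes0 hg; rewrite -[m]addn0; apply: vanishesM.
Qed.

Lemma vanishes_box_fst s : expNi s = -1 ->
  vanishes 2 (fun x => box_fst (zfst s x)).
Proof.
move=> es; apply: vanishes_div; last by solve_tends.
apply: (@vanishesX _ 1 2); apply: (@tends0_vanishes _ _ (1 + expNi s)).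
  by solve_tends.
by rewrite es subrr.
Qed.

Lemma vanishes_box_snd t : 1 + expNi t + expNi t ^+ 2 = 0 ->
  vanishes 2 (fun x => box_snd (zsnd t x)).
Proof.
move=> et; apply: vanishes_div; last by solve_tends.
apply: (@vanishesX _ 1 2).
by apply: tends0_vanishes et; solve_tends.
Qed.

(** Each of the two hypotheses makes one of the two polynomials vanish to
    order 1. *)
Lemma vanishes_diag_factor s t :
  2 + expNi t + expNi s * expNi t + 2 * expNi s * expNi t ^+ 2 = 0 ->
  2 * expNi s + expNi t + expNi s * expNi t + 2 * expNi t ^+ 2 = 0 ->
  vanishes 2 (fun x => diag_factor (zfst s x) (zsnd t x)).
Proof.
move=> e1 e2; apply: vanishes_div; last by solve_tends.
by apply: (@vanishesM _ 1 1); [apply: tends0_vanishes e1|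
  apply: tends0_vanishes e2]; solve_tends.
Qed.

Lemma vanishes_delta1 s : expNi s ^+ 2 = 1 ->
  vanishes 2 (fun x => delta1 (zfst s x)).
Proof.
move=> es; apply: vanishesN; apply: vanishes_div; last by solve_tends.
apply: (@vanishesX _ 1 2); apply: (@tends0_vanishes _ _ (1 - expNi s ^+ 2)).
  by solve_tends.
by rewrite es subrr.
Qed.

Lemma vanishes_delta2 t : expNi t ^+ 3 = 1 ->
  vanishes 2 (fun x => delta2 (zsnd t x)).
Proof.
move=> et; apply: vanishesN; apply: vanishes_div; last by solve_tends.
apply: (@vanishesX _ 1 2); apply: (@tends0_vanishes _ _ (1 - expNi t ^+ 3)).
  by solve_tends.
by rewrite et subrr.
Qed.

(** The box factor vanishes to order p and the diagonal factor to order d, where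
    (p, d) = (2, 2) if just one of the two coordinates is 1, and (4, 0) if none
    is. *)
Lemma vanishes_fourdir_symbol k s t :
  expNi s = 1 \/ expNi s = -1 ->
  expNi t = 1 \/ 1 + expNi t + expNi t ^+ 2 = 0 ->
  ~ (expNi s = 1 /\ expNi t = 1) ->
  vanishes (2 * k) (fun x => fourdir_symbol k (zfst s x) (zsnd t x)).
Proof.
move=> hs ht st1.
have combine p d : (2 * k <= p * uphalf k + d * k./2)%N ->
    vanishes p (fun x => box_fst (zfst s x) * box_snd (zsnd t x)) ->
    vanishes d (fun x => diag_factor (zfst s x) (zsnd t x)) ->
    vanishes (2 * k) (fun x => fourdir_symbol k (zfst s x) (zsnd t x)).
  move=> kpd hp hd; apply: vanishesW kpd _; rewrite -[X in vanishes X]add0n addnA.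
  apply: vanishesM (vanishesX _ hd); apply: vanishesM (vanishesX _ hp).
  exact: vanishes_cst.
have bounded_fst : vanishes 0 (fun x => box_fst (zfst s x)).
  apply: (@tends_vanishes0 _ _ (box_fst (expNi s))).
  by rewrite /box_fst; solve_tends.
have bounded_snd : vanishes 0 (fun x => box_snd (zsnd t x)).
  apply: (@tends_vanishes0 _ _ (box_snd (expNi t))).
  by rewrite /box_snd; solve_tends.
have k2 : (2 * k <= 2 * uphalf k + 2 * k./2)%N.
  by rewrite uphalf_half; lia.
case: hs => es; case: ht => et.
- by case: st1.
- apply: (combine 2 2) => //.
    exact: (@vanishesM _ 0 2 _ _ bounded_fst (vanishes_box_snd et)).
  (* With a = 1 both polynomials equal 2 (1 + b + b^2). *)
  by apply: vanishes_diag_factor; rewrite es -[RHS](mulr0 2) -et; ring.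
- apply: (combine 2 2) => //.
    exact: (@vanishesM _ 2 0 _ _ (vanishes_box_fst es) bounded_snd).
  by apply: vanishes_diag_factor; rewrite es et; ring.
- apply: (combine 4 0); first by rewrite uphalf_half; lia.
    exact: (@vanishesM _ 2 2 _ _ (vanishes_box_fst es) (vanishes_box_snd et)).
  apply: (@tends_vanishes0 _ _ (diag_factor (expNi s) (expNi t))).
  by rewrite /diag_factor; solve_tends.
Qed.

(** Passing from i to i + 1 costs two orders in B_(n-i), and the additional factor
    delta1 or delta2 gives them back. *)
Lemma vanishes_approx_symbol c n l s t : (l < n)%N ->
  expNi s = 1 \/ expNi s = -1 ->
  expNi t = 1 \/ 1 + expNi t + expNi t ^+ 2 = 0 ->
  ~ (expNi s = 1 /\ expNi t = 1) ->
  vanishes (2 * n) (fun x => approx_symbol c n l (zfst s x) (zsnd t x)).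
Proof.
move=> ln hs ht st1.
have es2 : expNi s ^+ 2 = 1 by case: hs => ->; rewrite ?sqrrN expr1n.
have et3 : expNi t ^+ 3 = 1.
  case: ht => [->|e]; first by rewrite expr1n.
  by apply/subr0_eq; rewrite -[RHS](mulr0 (expNi t - 1)) -e; ring.
apply: vanishes_sum => i; rewrite mem_index_iota ltnS => /andP[_ il].
have -> : (2 * n = 2 * (n - i) + 2 * i)%N by lia.
apply: vanishesM; first exact: vanishes_fourdir_symbol.
apply: vanishes_sum => j; rewrite mem_index_iota ltnS => /andP[_ ji].
have -> : (2 * i = 0 + 2 * (i - j) + 2 * j)%N by lia.
apply: vanishesM; last exact/vanishesX/vanishes_delta2.
apply: vanishesM; first exact: vanishes_cst.
exact/vanishesX/vanishes_delta1.
Qed.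

Lemma expNi_pi : expNi pi = -1 :> R[i].
Proof.
by rewrite /expNi cospi sinpi; apply/eqP; rewrite eq_complex /= !oppr0 !eqxx.
Qed.

Lemma expNi_third : 1 + expNi (2 * pi / 3) + expNi (2 * pi / 3) ^+ 2 = 0 :> R[i].
Proof.
set w := expNi _.
have w3 : w ^+ 3 = 1.
  rewrite 2!exprS expr1 -!expNiD.
  have -> : 2 * pi / 3 + (2 * pi / 3 + 2 * pi / 3) = pi + pi :> R by field.
  by rewrite expNiD expNi_pi mulrNN mulr1.
(* sin (2 pi / 3) > 0, so w is not real *)
have w1 : w - 1 != 0.
  rewrite subr_eq0 eq_complex negb_and /= oppr_eq0; apply/orP; right.
  by rewrite gt_eqF // sin_gt0_pi //; have := pi_gt0 R; lra.
apply: (mulfI w1); rewrite mulr0.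
have -> : (w - 1) * (1 + w + w ^+ 2) = w ^+ 3 - 1 by ring.
by rewrite w3 subrr.
Qed.

Lemma expNi_two_thirds :
  1 + expNi (2 * pi * (2 / 3)) + expNi (2 * pi * (2 / 3)) ^+ 2 = 0 :> R[i].
Proof.
have -> : 2 * pi * (2 / 3) = 2 * pi / 3 + 2 * pi / 3 :> R by field.
rewrite expNiD; have := expNi_third; set w := expNi _ => ew.
(* 1 + w^2 + w^4 = (1 + w + w^2) (1 - w + w^2) *)
by rewrite -[RHS](mulr0 (1 - w + w ^+ 2)) -ew; ring.
Qed.

End Symbol.

Theorem proposition5p5 (R : realType) (q n l : nat) (c : nat -> nat -> R)
    (hq : (1 <= q)%N) (hqn : (q <= n)%N) (hl : (l < n)%N)
    (hc : scheme_coefficients n l c) :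
  (forall y : R * R,
      y.1 \in [:: 0; 1 / 2] -> y.2 \in [:: 0; 1 / 3; 2 / 3] -> y <> (0, 0) ->
      (limsup0 (fun x =>
          cmod (approx_symbol_hat c n l
                  (x.1 + 2 * pi * y.1, x.2 + 2 * pi * y.2))
          / enorm x ^+ (2 * q))%R < +oo)%E)
  /\
  (limsup0 (fun x => cmod (approx_symbol_hat c n l x - 6) / enorm x)%R
     < +oo)%E.
Proof.
split=> [[y1 y2] /= hy1 hy2 y0|].
  apply: (@limsup0_vanishes _ (2 * q) (fun x => approx_symbol c n l
    (zfst (2 * pi * y1) x) (zsnd (2 * pi * y2) x))).
  apply: (@vanishesW _ _ (2 * n)); first by rewrite leq_mul2l.
  have es : (y1 = 0 /\ expNi (2 * pi * y1) = 1) \/ expNi (2 * pi * y1) = -1.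
    move: hy1; rewrite !inE => /orP[] /eqP ->.
      by left; rewrite mulr0 expNi0.
    by right; rewrite mulrC mulrA mul1r mulVf ?pnatr_eq0// mul1r expNi_pi.
  have et : (y2 = 0 /\ expNi (2 * pi * y2) = 1) \/
      1 + expNi (2 * pi * y2) + expNi (2 * pi * y2) ^+ 2 = 0.
    move: hy2; rewrite !inE => /or3P[] /eqP ->.
    - by left; rewrite mulr0 expNi0.
    - by right; rewrite mul1r; exact: expNi_third.
    - by right; exact: expNi_two_thirds.
  apply: vanishes_approx_symbol => //; [by tauto|by tauto|].
  move=> [s1 t1]; case: es => [[y10 _]|]; last first.
    by rewrite s1 => /eqP; rewrite -addr_eq0 -(natrD _ 1 1) pnatr_eq0.
  case: et => [[y20 _]|]; first by apply: y0; rewrite y10 y20.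
  by rewrite t1 expr1n -(natrD _ 1 1) -(natrD _ 2 1) => /eqP; rewrite pnatr_eq0.
have := limsup0_vanishes (tends_approx_symbol c n l 0 0).
set F := (fun x => _ / _); set G := (fun x => _ / _).
suff -> : F = G by [].
apply/funext => x.
by rewrite /F /G /approx_symbol_hat /zfst /zsnd !addr0 expNi0 hc.1 expr1.
Qed.
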